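(* Let $R$ be a unital ring and let $u \in R_q^{-1}$. Then $u$ is von Neumann regular, and there exists $v\in R$ such that $u=uvu$, $v=vuv$, and the two idempotents $1-uv$ and $1-vu$ are centrally orthogonal, i.e. $(1-uv)R(1-vu)=0$ and $(1-vu)R(1-uv)=0$. In particular, $v\in R_q^{-1}$.
   Context: Rings are associative. For elements $x,y$ of a unital ring $R$ write $x\perp y$ (centrally orthogonal) if $xRy=0$ and $yRx=0$. An element $u\in R$ is quasi-invertible, written $u\in R_q^{-1}$, if there exist $a,b\in R$ with $(1-ua)\perp(1-bu)$. An element $a\in R$ is von Neumann regular if $a=axa$ for some $x\in R$. *)

(* Defs.v *)
From mathcomp Require Import all_boot all_algebra.

Set Implicit Arguments.
Unset Strict Implicit.
Unset Printing Implicit Defensive.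

Import GRing.Theory.
Local Open Scope ring_scope.

(* [pzRingType] is used throughout: unital associative rings, not necessarily
   commutative, with the zero ring allowed. *)

Definition centrally_orthogonal (R : pzRingType) (x y : R) : Prop :=
  (forall r : R, x * r * y = 0) /\ (forall r : R, y * r * x = 0).

Definition quasi_invertible (R : pzRingType) (u : R) : Prop :=
  exists a b : R, centrally_orthogonal (1 - u * a) (1 - b * u).

Definition von_neumann_regular (R : pzRingType) (a : R) : Prop :=
  exists x : R, a = a * x * a.

Definition idempotent_elt (R : pzRingType) (e : R) : Prop := e * e = e.

(* Main.v *)
(* If [(1 - ua) u (1 - bu) = 0], expanding gives [u = uwu] for
   [w = a + b - aub], the element with
   [1 - uw = (1 - ua)(1 - ub)] and [1 - wu = (1 - au)(1 - bu)].
   These factorizations transfer central orthogonality from [1 - ua], [1 - bu]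
   to [1 - uw], [1 - wu], and [v = wuw] satisfies [uv = uw], [vu = wu]. *)
Require Import Defs.
From mathcomp Require Import all_boot all_algebra.

Import GRing.Theory.
Local Open Scope ring_scope.

Lemma subr1M (R : pzRingType) (x y : R) :
  (1 - x) * (1 - y) = 1 - (x + y - x * y).
Proof.
rewrite mulrBl mul1r mulrBr mulr1 !opprB opprD -addrA; congr (_ + _).
by rewrite addrCA [- y - x]addrC.
Qed.

Lemma subr1_mul_adjoin_r (R : pzRingType) (u a b : R) :
  1 - u * (a + b - a * u * b) = (1 - u * a) * (1 - u * b).
Proof. by rewrite subr1M mulrBr mulrDr !mulrA. Qed.

Lemma subr1_mul_adjoin_l (R : pzRingType) (u a b : R) :
  1 - (a + b - a * u * b) * u = (1 - a * u) * (1 - b * u).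
Proof. by rewrite subr1M mulrBl mulrDl !mulrA. Qed.

(** In one product [c] and [d] are absorbed into the arbitrary middle element, as [c * r * d]; in
    the other they stay outside [y * r * x = 0]. *)
Lemma centrally_orthogonalM (R : pzRingType) (x y c d : R) :
  centrally_orthogonal x y -> centrally_orthogonal (x * c) (d * y).
Proof.
move=> [xy yx]; split=> r.
  by rewrite -(mulrA x) mulrA -(mulrA x) xy.
by rewrite mulrA -(mulrA d) -(mulrA d) yx mulr0 mul0r.
Qed.

Lemma idempotent_subr1 (R : pzRingType) (e : R) :
  idempotent_elt e -> idempotent_elt (1 - e).
Proof.
rewrite /idempotent_elt => ee.
by rewrite mulrBl mul1r mulrBr mulr1 ee subrr subr0.
Qed.

Theorem proposition2p2 (R : pzRingType) (u : R) (hu : quasi_invertible u) :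
  von_neumann_regular u /\
  exists v : R,
    [/\ u = u * v * u /\ v = v * u * v,
        idempotent_elt (1 - u * v),
        idempotent_elt (1 - v * u),
        centrally_orthogonal (1 - u * v) (1 - v * u)
      & quasi_invertible v].
Proof.
case: hu => a [b hab]; set w := a + b - a * u * b.
have how : centrally_orthogonal (1 - u * w) (1 - w * u).
  by rewrite subr1_mul_adjoin_r subr1_mul_adjoin_l; apply: centrally_orthogonalM.
have ubu : (1 - u * b) * u = u * (1 - b * u).
  by rewrite mulrBl mulrBr mul1r mulr1 mulrA.
have uwu : u * w * u = u.
  (* [u - uwu = (1 - ua)(1 - ub)u = (1 - ua)u(1 - bu)], which vanishes by [hab] with middle element
     [u]. *)
  apply/eqP; rewrite eq_sym -subr_eq0 -{1}[u]mul1r -mulrBl subr1_mul_adjoin_r.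
  by rewrite -mulrA ubu mulrA hab.1.
have uv : u * (w * u * w) = u * w by rewrite !mulrA uwu.
have vu : w * u * w * u = w * u by rewrite -!mulrA (mulrA u) uwu.
split; first by exists w.
(* Passing from [w] to [wuw] forces [v = vuv] and leaves both idempotents unchanged. *)
exists (w * u * w); split; rewrite ?uv ?vu //.
- by rewrite !mulrA vu.
- by apply: idempotent_subr1; rewrite /idempotent_elt mulrA uwu.
- by apply: idempotent_subr1; rewrite /idempotent_elt mulrA vu.
(* With [u] as both witnesses, the condition on [v] is [how] with its two sides exchanged. *)
by exists u, u; rewrite uv vu; case: how.
Qed.
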